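(* Let $\mathcal V$ be a variety. The following conditions are equivalent. (1) $\mathcal V$ is congruence distributive. (2) There is some $h$ such that every algebra in $\mathcal V$ satisfies $\Theta \cap (\sigma\circ\sigma) \subseteq (\Theta\cap\sigma)^{\circ h}$ for every tolerance $\Theta$ and every U-admissible relation $\sigma$. (3) There is some $k$ such that every algebra in $\mathcal V$ satisfies $\alpha\cap(\sigma\circ\sigma)\subseteq(\alpha\cap\sigma)^{\circ k}$ for every congruence $\alpha$ and every binary relation $\sigma$ expressible as the set-theoretical union of two congruences. Moreover, each of the conditions (1), (2), (3) holds for $\mathcal V$ if and only if it holds for the single algebra $\mathbf F_{\mathcal V}(3)$ (i.e. with ''every algebra in $\mathcal V$'' replaced by ''$\mathbf F_{\mathcal V}(3)$'', and with (1) read as: the congruence lattice of $\mathbf F_{\mathcal V}(3)$ is distributive).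
   Context: A binary relation on an algebra $\mathbf A$ is admissible if it is compatible with all operations (a subalgebra of $\mathbf A\times\mathbf A$). A tolerance is a reflexive, symmetric and admissible relation. A binary relation on $\mathbf A$ is U-admissible if it is the set-theoretical union of some nonempty set of reflexive and admissible relations on $\mathbf A$ (it need not itself be admissible). $\circ$ denotes relational composition, and $R^{\circ h}=R\circ R\circ\cdots\circ R$ with $h$ factors. $\mathbf F_{\mathcal V}(3)$ is the free algebra in $\mathcal V$ generated by 3 elements. A variety is congruence distributive if all its algebras have distributive congruence lattices. *)

(* Defs.v *)
From mathcomp Require Import all_boot all_classical.

Set Implicit Arguments.
Unset Strict Implicit.
Unset Printing Implicit Defensive.

Local Open Scope classical_set_scope.
Local Open Scope relation_scope.

(** * Algebras, terms, varieties *)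

Record signature := Signature {
  op : Type;
  arity : op -> nat
}.

Record algebra (S : signature) := Algebra {
  carrier :> Type;
  interp : forall o : op S, ('I_(arity o) -> carrier) -> carrier;
  carrier_inhabited : inhabited carrier
}.

Inductive term (S : signature) (X : Type) : Type :=
| Var of X
| App (o : op S) of ('I_(arity o) -> term S X).

Arguments Var {S X} _.
Arguments App {S X} o _.

Fixpoint eval (S : signature) (A : algebra S) (X : Type) (v : X -> A)
    (t : term S X) : A :=
  match t with
  | Var x => v x
  | App o f => interp (fun i => eval v (f i))
  end.

Definition models (S : signature) (E : term S nat -> term S nat -> Prop)
    (A : algebra S) : Prop :=
  forall l r, E l r -> forall v : nat -> A, eval v l = eval v r.

(* [algebra S -> Prop] is deliberately not written [set (algebra S)]: [set] is
   universe monomorphic, and it is also applied below to the carriers. *)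
Definition variety (S : signature) (V : algebra S -> Prop) : Prop :=
  exists E : term S nat -> term S nat -> Prop, forall A, V A <-> models E A.

Definition homomorphism (S : signature) (A B : algebra S) (h : A -> B) : Prop :=
  forall (o : op S) (f : 'I_(arity o) -> A),
    h (interp f) = interp (fun i => h (f i)).

(* Universal property; the map [x] need not be injective, as happens when every
   algebra of [V] has a single element. *)
Definition free_algebra (S : signature) (V : algebra S -> Prop) (X : Type)
    (F : algebra S) (x : X -> F) : Prop :=
  V F /\
  forall (A : algebra S) (v : X -> A), V A ->
    exists! h : F -> A, homomorphism h /\ forall i, h (x i) = v i.

(** * Binary relations on an algebra *)

Section Relations.
Variables (S : signature) (A : algebra S).
Implicit Types R T a b c s : set (A * A).

Definition admissible R : Prop :=
  forall (o : op S) (f g : 'I_(arity o) -> A),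
    (forall i, R (f i, g i)) -> R (interp f, interp g).

Definition reflexive_rel R : Prop := forall x, R (x, x).
Definition symmetric_rel R : Prop := forall x y, R (x, y) -> R (y, x).
Definition transitive_rel R : Prop :=
  forall x y z, R (x, y) -> R (y, z) -> R (x, z).

Definition tolerance R : Prop :=
  [/\ reflexive_rel R, symmetric_rel R & admissible R].

Definition congruence R : Prop :=
  [/\ reflexive_rel R, symmetric_rel R, transitive_rel R & admissible R].

Definition U_admissible s : Prop :=
  exists C : set (set (A * A)),
    [/\ C !=set0,
        forall R, C R -> reflexive_rel R /\ admissible R
      & s = \bigcup_(R in C) R].

Definition union_of_two_congruences s : Prop :=
  exists b c, [/\ congruence b, congruence c & s = b `|` c].

(* [R \; ... \; R] with exactly [h] factors when [0 < h]. *)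
Definition rel_pow R (h : nat) : set (A * A) :=
  iterop h (fun R1 R2 => R1 \; R2) R diagonal.

(* The meet in the congruence lattice is the intersection. *)
Definition congruence_join a b : set (A * A) := smallest congruence (a `|` b).

Definition distributive_congruence_lattice : Prop :=
  forall a b c, congruence a -> congruence b -> congruence c ->
    a `&` congruence_join b c = congruence_join (a `&` b) (a `&` c).

Definition tolerance_inclusion (h : nat) : Prop :=
  forall T s, tolerance T -> U_admissible s ->
    T `&` (s \; s) `<=` rel_pow (T `&` s) h.

Definition congruence_inclusion (k : nat) : Prop :=
  forall a s, congruence a -> union_of_two_congruences s ->
    a `&` (s \; s) `<=` rel_pow (a `&` s) k.

End Relations.

(** * Existence of free algebras *)

Section FreeAlgebraExists.
Variables (S : signature) (V : algebra S -> Prop) (X : Type) (x0 : X).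

Definition term_equiv (t u : term S X) : Prop :=
  forall (A : algebra S) (v : X -> A), V A -> eval v t = eval v u.

(* A choice of one representative in every class of [term_equiv]. *)
Lemma term_reprP :
  {c : term S X -> term S X | (forall t, term_equiv t (c t)) /\
    forall t u, term_equiv t u -> c t = c u}.
Proof.
have ex (P : term S X -> Prop) : exists u, (exists t, P t) -> P u.
  have [[t Pt]|nP] := pselect (exists t, P t); first by exists t.
  by exists (Var x0).
pose c t := projT1 (cid (ex (term_equiv t))).
exists c; split=> [t|t u tu].
  rewrite /c; case: cid => u /= Hu; apply: Hu; exists t => A v _; reflexivity.
rewrite /c; suff -> : term_equiv t = term_equiv u by [].
apply: funext => w; apply: propext; split=> H A v VA.
  by rewrite -(tu A v VA) H.
by rewrite (tu A v VA) H.
Qed.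

Let c := sval term_reprP.
Let cE : forall t, term_equiv t (c t) := (svalP term_reprP).1.
Let c_eq : forall t u, term_equiv t u -> c t = c u := (svalP term_reprP).2.

Let cK t : c (c t) = c t.
Proof. by apply: c_eq => A v VA; rewrite -cE. Qed.

Let Fcar := {t : term S X | c t = t}.
Let pr (t : term S X) : Fcar := exist _ (c t) (cK t).

Let prE (t u : term S X) : term_equiv t u -> pr t = pr u.
Proof.
move=> /c_eq tu; rewrite /pr; move: (cK t) (cK u).
by rewrite tu => p q; rewrite (Prop_irrelevance p q).
Qed.

Let prK (a : Fcar) : pr (sval a) = a.
Proof.
case: a => t ct /=; rewrite /pr; move: (cK t).
by rewrite ct => p; rewrite (Prop_irrelevance p ct).
Qed.

Let F : algebra S :=
  @Algebra S Fcar (fun o f => pr (App o (fun i => sval (f i))))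
    (inhabits (pr (Var x0))).

Fixpoint term_subst (Y : Type) (w : Y -> term S X) (t : term S Y) : term S X :=
  match t with
  | Var y => w y
  | App o f => App o (fun i => term_subst w (f i))
  end.

Let eval_subst Y (w : Y -> term S X) (A : algebra S) (v : X -> A) t :
  eval v (term_subst w t) = eval (fun y => eval v (w y)) t.
Proof.
elim: t => //= o f IH; congr interp; apply: funext => i; exact: IH.
Qed.

Let evalF Y (w : Y -> F) t : eval w t = pr (term_subst (fun y => sval (w y)) t).
Proof.
elim: t => /= [y|o f IH]; first by rewrite prK.
apply: prE => A v VA /=; congr interp; apply: funext => i.
by rewrite IH /= -cE.
Qed.

Lemma free_algebra_exists : variety V ->
  exists (F : algebra S) (x : X -> F), free_algebra V x.
Proof.
move=> [E VE]; exists F, (fun i => pr (Var i)); split.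
  apply/VE => l r lr v; rewrite !evalF; apply: prE => A u VA.
  by rewrite !eval_subst; apply: (VE A).1.
move=> A v VA; exists (fun a : F => eval v (sval a)); split.
  split=> [o f|i] /=; by rewrite -cE.
move=> h [hh hx]; apply: funext => a; rewrite -[in RHS](prK a).
have key t : h (pr t) = eval v t.
  elim: t => /= [i|o f IH]; first exact: hx.
  have -> : pr (App o f) = @interp S F o (fun i => pr (f i)).
    apply: prE => B u VB /=; congr interp; apply: funext => i; exact: cE.
  by rewrite hh; congr interp; apply: funext => i; rewrite IH.
by rewrite key.
Qed.

End FreeAlgebraExists.

(* Main.v *)
Require Import Defs.
From mathcomp Require Import all_boot all_classical.
From Stdlib Require Import Relation_Operators.

(** The proof goes through Jonsson terms and their directed variant.

    In [F(3)], generated by [x, y, z], let [a], [b], [c] be the kernels of the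
    endomorphisms sending [(x, y, z)] to [(x, y, x)], [(x, x, z)], [(x, z, z)].
    Since [(x, z)] lies in [a] and [x b y c z], distributivity of the congruence
    lattice of [F(3)], as well as the congruence inclusion in [F(3)] for the union
    [b `|` c], links [x] to [z] by steps in [a `&` b] or [a `&` c] ([free_chain]). Elements
    of [F(3)] are values of ternary terms ([free_generated]), so this is a chain
    of Jonsson terms for the variety ([jonsson_chain]).

    Such a chain is turned into directed Jonsson terms, that is absorbing terms
    [p] (those with [p(x, y, x) = x]) for which the pairs
    [(p(x, x, y), p(x, y, y))] form a directed path of binary terms from [x] to
    [y] ([directed_jonsson_terms]); this is a theorem of Kazda, Kozik, McKenzie
    and Moore. Write [u <= v] for a directed path from [u] to [v], and [u << v]
    for a path in which the linking terms need not be absorbing. If [t] is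
    absorbing, [t(u, m, w)] is [<=]-monotone in [u] and [w], and takes [m << m']
    to [<=]. The Jonsson chain gives a fence from [x] to [y] for [<=], and the
    task is to reverse its descending steps. This is done by the lemma
    [below_abs_iter]: if [k] and [g] are monotone, [u <= g u], [k u <= g u] and
    [u << k u], then [u <= k (g^n u)] for some [n], because [w = g^i u] satisfies
    [u <= t(w, w, k w)] for the successive terms [t] of the chain, with [i] going
    up by one whenever a descending step is met. Induction along the fence
    ([chain_below_abs]) then reaches [y].

    Directed terms give the tolerance inclusion: if [x R y S z] and [T] is a
    tolerance with [(x, z) \in T], each directed term [p] yields [p(x, x, z) R
    p(x, y, z) S p(x, z, z)], and these elements are [T]-related because [p] is
    absorbing ([absorbing_tolerance]). The number of steps depends only on the
    terms, so [h] is uniform. They also give distributivity, by following a path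
    from [x] to [z] inside [p(x, _, z)]. Finally the tolerance inclusion gives
    the congruence inclusion in each algebra, as a union of two congruences is
    U-admissible. The conditions for [F(3)] alone thus imply those for the
    variety, and conversely [F(3)] belongs to the variety. *)

Set Implicit Arguments.
Unset Strict Implicit.
Unset Printing Implicit Defensive.

Local Open Scope classical_set_scope.
Local Open Scope relation_scope.

(** * Terms and their evaluation *)

Definition pt2 (T : Type) (a b : T) (i : bool) : T := if i then b else a.

Definition pt3 (T : Type) (a b c : T) (i : 'I_3) : T :=
  match val i with 0 => a | 1 => b | _ => c end.

Definition i0 : 'I_3 := @Ordinal 3 0 isT.
Definition i1 : 'I_3 := @Ordinal 3 1 isT.
Definition i2 : 'I_3 := @Ordinal 3 2 isT.

Definition at2 (S : signature) (A : algebra S) (t : term S bool) (a b : A) : A :=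
  eval (pt2 a b) t.
Definition at3 (S : signature) (A : algebra S) (t : term S 'I_3) (a b c : A) : A :=
  eval (pt3 a b c) t.

Lemma pt3_eta (T : Type) (v : 'I_3 -> T) : pt3 (v i0) (v i1) (v i2) = v.
Proof.
apply: funext => -[[|[|[|//]]] ilt]; congr (v _); exact: val_inj.
Qed.

Lemma comp_pt3 (T U : Type) (h : T -> U) (a b c : T) :
  (fun i => h (pt3 a b c i)) = pt3 (h a) (h b) (h c).
Proof. by apply: funext => -[[|[|]] ilt]. Qed.

Section Eval.
Variables (S : signature) (X : Type).
Implicit Types (A B : algebra S) (t : term S X).

Lemma eval_ext A (v w : X -> A) t : (forall i, v i = w i) -> eval v t = eval w t.
Proof. by move=> vw; congr eval; apply: funext. Qed.

Lemma eval_term_subst Y (s : X -> term S Y) A (v : Y -> A) t :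
  eval v (term_subst s t) = eval (fun i => eval v (s i)) t.
Proof. by elim: t => //= o f IH; congr interp; apply: funext => i. Qed.

Lemma hom_eval A B (h : A -> B) (v : X -> A) t :
  homomorphism h -> h (eval v t) = eval (fun i => h (v i)) t.
Proof.
move=> hh; elim: t => //= o f IH.
by rewrite hh; congr interp; apply: funext => i.
Qed.

Lemma eval_admissible A (R : set (A * A)) (v w : X -> A) t :
  admissible R -> (forall i, R (v i, w i)) -> R (eval v t, eval w t).
Proof. by move=> admR Rvw; elim: t => //= o f IH; apply: admR. Qed.

End Eval.

Lemma at3_admissible (S : signature) (A : algebra S) (R : set (A * A))
    (t : term S 'I_3) (a b c a' b' c' : A) :
  admissible R -> R (a, a') -> R (b, b') -> R (c, c') ->
  R (at3 t a b c, at3 t a' b' c').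
Proof.
by move=> admR Ra Rb Rc; apply: eval_admissible => // -[[|[|]] ilt].
Qed.

(** * From Jonsson terms to directed Jonsson terms *)

Section DirectedTerms.
Variables (S : signature) (V : algebra S -> Prop).
Implicit Types (A : algebra S) (u v w m : term S bool) (p t : term S 'I_3).

Definition absorbing t := forall A, V A -> forall a b : A, at3 t a b a = a.

(** The initial segments of lists of Jonsson terms, represented by their last
    term: Jonsson's condition is [jonsson_chain (Var i2)]. Strict alternation of
    the two kinds of steps is not imposed, so that a chain of pairs in
    [a `&` (b `|` c)] is read off directly as a chain of terms. *)
Inductive jonsson_chain : term S 'I_3 -> Prop :=
| chain_start : jonsson_chain (Var i0)
| chain_left t t' : jonsson_chain t -> absorbing t' ->
    (forall A, V A -> forall a c : A, at3 t a a c = at3 t' a a c) ->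
    jonsson_chain t'
| chain_right t t' : jonsson_chain t -> absorbing t' ->
    (forall A, V A -> forall a c : A, at3 t a c c = at3 t' a c c) ->
    jonsson_chain t'.

Lemma chain_absorbing t : jonsson_chain t -> absorbing t.
Proof. by case. Qed.

Definition idempotent u := forall A, V A -> forall a : A, at2 u a a = a.

Definition links p u v := forall A, V A -> forall a b : A,
  at3 p a a b = at2 u a b /\ at3 p a b b = at2 v a b.

(** In the algebra of binary terms, [below] is the transitive closure of the
    reflexive admissible relation generated by [(x, y)]. *)
Definition below := clos_trans _ (fun u v => exists p, links p u v).

(** Directed Jonsson terms exist exactly when [x] is [below_abs] [y]. *)
Definition below_abs :=
  clos_trans _ (fun u v => exists2 p, absorbing p & links p u v).

Definition comp t u m w : term S bool := term_subst (pt3 u m w) t.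

Lemma at2_comp A t u m w (a b : A) :
  at2 (comp t u m w) a b = at3 t (at2 u a b) (at2 m a b) (at2 w a b).
Proof. by rewrite /at2 /comp eval_term_subst comp_pt3. Qed.

Definition spread u (i j : 'I_3) : term S 'I_3 :=
  term_subst (pt2 (Var i) (Var j)) u.

Lemma at3_spread A u i j (a b c : A) :
  at3 (spread u i j) a b c = at2 u (pt3 a b c i) (pt3 a b c j).
Proof. by rewrite /at3 /spread eval_term_subst; apply: eval_ext => -[]. Qed.

Lemma at3_subst A t p p' p'' (a b c : A) :
  at3 (term_subst (pt3 p p' p'') t) a b c =
  at3 t (at3 p a b c) (at3 p' a b c) (at3 p'' a b c).
Proof. by rewrite /at3 eval_term_subst comp_pt3. Qed.

Lemma below_abs_idempotent u v : below_abs u v -> idempotent u /\ idempotent v.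
Proof.
elim=> [{}u {}v [p p_abs puv]|u1 u2 u3 _ [] ? _ _ [_] ?]; last by split.
by split=> A VA a; have [pu pv] := puv A VA a a; rewrite -?pu -?pv p_abs.
Qed.

Lemma below_abs_eq u v : idempotent u ->
  (forall A, V A -> forall a b : A, at2 u a b = at2 v a b) -> below_abs u v.
Proof.
move=> uid uv; apply: t_step; exists (spread u i0 i2) => A VA a b.
  by rewrite at3_spread uid.
by rewrite !at3_spread -uv.
Qed.

Lemma below_abs_refl u : idempotent u -> below_abs u u.
Proof. by move=> uid; apply: below_abs_eq. Qed.

Lemma below_abs_sub u v : below_abs u v -> below u v.
Proof.
elim=> [{}u {}v [p _ puv]|u1 u2 u3 _ u12 _ u23]; first by apply: t_step; exists p.
exact: t_trans u12 u23.
Qed.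

Lemma below_refl u : below u u.
Proof. by apply: t_step; exists (spread u i0 i2) => A VA a b; rewrite !at3_spread. Qed.

(** Hence the second argument of a comparison can stay fixed at [y] throughout:
    every idempotent [u] forms with [y] a pair to which the chain applies. *)
Lemma below_top u : idempotent u -> below u (Var true).
Proof.
move=> uid; apply: t_step; exists (spread u i1 i2) => A VA a b.
by rewrite !at3_spread uid.
Qed.

Lemma links_spread u : links (spread u i0 i2) u u.
Proof. by move=> A VA a b; rewrite !at3_spread. Qed.

Lemma links_comp t p p' p'' u u' m m' w w' :
  links p u u' -> links p' m m' -> links p'' w w' ->
  links (term_subst (pt3 p p' p'') t) (comp t u m w) (comp t u' m' w').
Proof.
move=> puu pmm pww A VA a b; rewrite !at3_subst !at2_comp.
by have [-> ->] := puu A VA a b; have [-> ->] := pmm A VA a b;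
  have [-> ->] := pww A VA a b.
Qed.

Lemma absorbing_spread u : idempotent u -> absorbing (spread u i0 i2).
Proof. by move=> uid A VA a b; rewrite at3_spread uid. Qed.

Lemma absorbing_subst t p p' p'' : absorbing t -> absorbing p -> absorbing p'' ->
  absorbing (term_subst (pt3 p p' p'') t).
Proof.
by move=> t_abs p_abs p''_abs A VA a b; rewrite at3_subst p_abs // p''_abs // t_abs.
Qed.

Lemma comp_below t u u' m m' w w' :
  below u u' -> below m m' -> below w w' -> below (comp t u m w) (comp t u' m' w').
Proof.
move=> uu mm ww; apply: t_trans (comp t u' m w) _ _ _.
  elim: uu => {u u'} [u u' [p puu]|? ? ? _ + _ +]; last exact: t_trans.
  apply: t_step; eexists.
  exact: links_comp puu (links_spread m) (links_spread w).
apply: t_trans (comp t u' m' w) _ _ _.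
  elim: mm => {m m'} [m m' [p pmm]|? ? ? _ + _ +]; last exact: t_trans.
  apply: t_step; eexists.
  exact: links_comp (links_spread u') pmm (links_spread w).
elim: ww => {w w'} [w w' [p pww]|? ? ? _ + _ +]; last exact: t_trans.
apply: t_step; eexists.
exact: links_comp (links_spread u') (links_spread m') pww.
Qed.

(** The middle coordinate may move along [below] only: its value at [(x, y, x)]
    is forgotten by an absorbing [t]. This gain from [below] to [below_abs] is
    what all later arguments feed on. *)
Lemma comp_below_abs t u u' m m' w w' : absorbing t ->
  below_abs u u' -> below m m' -> below_abs w w' ->
  below_abs (comp t u m w) (comp t u' m' w').
Proof.
move=> t_abs uu mm ww; have [_ u'id] := below_abs_idempotent uu.
have [wid _] := below_abs_idempotent ww.
apply: t_trans (comp t u' m w) _ _ _.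
  elim: uu {u'id} => {u u'} [u u' [p p_abs puu]|? ? ? _ + _ +]; last exact: t_trans.
  apply: t_step; eexists; last first.
    exact: links_comp puu (links_spread m) (links_spread w).
  by apply: absorbing_subst => //; apply: absorbing_spread.
apply: t_trans (comp t u' m' w) _ _ _.
  elim: mm => {m m'} [m m' [p pmm]|? ? ? _ + _ +]; last exact: t_trans.
  apply: t_step; eexists; last first.
    exact: links_comp (links_spread u') pmm (links_spread w).
  by apply: absorbing_subst => //; apply: absorbing_spread.
elim: ww {wid} => {w w'} [w w' [p p_abs pww]|? ? ? _ + _ +]; last exact: t_trans.
apply: t_step; eexists; last first.
  exact: links_comp (links_spread u') (links_spread m') pww.
by apply: absorbing_subst => //; apply: absorbing_spread.
Qed.

Definition monotone (f : term S bool -> term S bool) :=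
  forall u v, below_abs u v -> below_abs (f u) (f v).

Definition inflationary (f : term S bool -> term S bool) :=
  forall u, idempotent u -> below_abs u (f u).

Lemma iter_monotone f n : monotone f -> monotone (iter n f).
Proof. by move=> fmon; elim: n => //= n IH u v uv; apply/fmon/IH. Qed.

Lemma iter_inflationary f n : inflationary f -> inflationary (iter n f).
Proof.
move=> finfl; elim: n => [|n IH] u uid /=; first exact: below_abs_refl.
apply: t_trans (IH u uid) _; apply: finfl; exact: (below_abs_idempotent (IH u uid)).2.
Qed.

Lemma comp_idempotent t u m w :
  absorbing t -> idempotent u -> idempotent w -> idempotent (comp t u m w).
Proof. by move=> t_abs uid wid A VA a; rewrite at2_comp uid // wid // t_abs. Qed.

(** For [w = g^i u] one keeps [u <= t(w, w, k w)] along the chain. Equality at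
    [(x, x, z)] preserves this. At an equality at [(x, z, z)], raise the middle
    argument to [k w], change [t] into [t'], and then raise all three arguments:
    the middle one from [k w] to [g w], the outer ones by [w <= g w] and
    [k w <= k (g w)]. The exponent depends on the chain alone, not on [u], which
    lets the result define a monotone function of [u]. *)
Lemma below_abs_iter (g k : term S bool -> term S bool) :
  jonsson_chain (Var i2) -> monotone k -> inflationary g ->
  (forall u, idempotent u -> below_abs (k u) (g u)) ->
  (forall u, idempotent u -> below u (k u)) ->
  exists n, forall u, idempotent u -> below_abs u (k (iter n g u)).
Proof.
move=> chain kmon ginfl kg uk.
suff key t : jonsson_chain t -> exists n, forall u, idempotent u ->
    let w := iter n g u in below_abs u (comp t w w (k w)) by exact: key chain.
elim=> [|{}t t' t_chain [n IH] t'_abs tt'|{}t t' t_chain [n IH] t'_abs tt'].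
- by exists 0 => u uid; apply: below_abs_refl.
- exists n => u uid /=; apply: t_trans (IH u uid) _.
  apply: below_abs_eq => [|A VA a b]; last by rewrite !at2_comp tt'.
  exact: (below_abs_idempotent (IH u uid)).2.
- exists n.+1 => u uid /=; apply: t_trans (IH u uid) _.
  have t_abs := chain_absorbing t_chain.
  have [_ wid] := below_abs_idempotent (iter_inflationary n ginfl uid).
  move: (iter n g u) wid => w wid.
  have wg := ginfl w wid; have kwg := kg w wid; have wk := uk w wid.
  have [kwid gwid] := below_abs_idempotent kwg.
  apply: t_trans (comp t w (k w) (k w)) _ _ _.
    by apply: comp_below_abs => //; apply: below_abs_refl.
  apply: t_trans (comp t' w (k w) (k w)) _ _ _.
    apply: below_abs_eq => [|A VA a b]; last by rewrite !at2_comp tt'.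
    exact: comp_idempotent.
  apply: comp_below_abs => //; first exact: below_abs_sub.
  exact: kmon.
Qed.

(** Starting from [u <= t(f u, f u, y)], an equality of [t] and [t'] at
    [(x, z, z)] gives only [u <= t'(f u, y, y) = g u], which is above the wanted
    value [k u = t'(f u, f u, y)]. The previous lemma applied to these [g] and
    [k] gives [u <= k (g^n u)], so [f] can be replaced by [f \o g^n]. *)
Lemma chain_below_abs t : jonsson_chain (Var i2) -> jonsson_chain t ->
  exists f, [/\ monotone f, inflationary f &
    forall u, idempotent u -> below_abs u (comp t (f u) (f u) (Var true))].
Proof.
move=> chain.
have yid : idempotent (Var true) by [].
elim=> [|{}t t' t_chain [f [fmon finfl tf]] t'_abs tt'|
         {}t t' t_chain [f [fmon finfl tf]] t'_abs tt'].
- by exists id; split=> // u uid; apply: below_abs_refl.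
- exists f; split=> // u uid; apply: t_trans (tf u uid) _.
  apply: below_abs_eq => [|A VA a b]; last by rewrite !at2_comp tt'.
  exact: (below_abs_idempotent (tf u uid)).2.
have t_abs := chain_absorbing t_chain.
have fid u : idempotent u -> idempotent (f u).
  by move=> uid; apply: (below_abs_idempotent (finfl u uid)).2.
pose g u := comp t' (f u) (Var true) (Var true).
pose k u := comp t' (f u) (f u) (Var true).
have gmon : monotone g.
  move=> u v uv; apply: comp_below_abs => //; first exact: fmon.
    exact: below_refl.
  exact: below_abs_refl.
have kmon : monotone k.
  move=> u v uv; apply: comp_below_abs => //; first exact: fmon.
    exact/below_abs_sub/fmon.
  exact: below_abs_refl.
have ginfl : inflationary g.
  move=> u uid; apply: t_trans (tf u uid) _.
  apply: t_trans (comp t (f u) (Var true) (Var true)) _ _ _.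
    apply: comp_below_abs => //; try (apply: below_abs_refl; auto).
    exact/below_top/fid.
  apply: below_abs_eq => [|A VA a b]; last by rewrite !at2_comp tt'.
  by apply: comp_idempotent => //; apply: fid.
have [||n un] := below_abs_iter chain kmon ginfl.
- move=> u uid; apply: comp_below_abs => //; try (apply: below_abs_refl; auto).
  exact/below_top/fid.
- move=> u uid; apply: t_trans (below_abs_sub (finfl u uid)) _.
  apply: t_trans (comp t' (f u) (f u) (f u)) _ _ _.
    apply/below_abs_sub/below_abs_eq => [|A VA a b]; first exact: fid.
    by rewrite at2_comp t'_abs.
  by apply: comp_below; try exact: below_refl; apply/below_top/fid.
exists (f \o iter n g); split=> [u v uv|u uid|] //=.
  exact/fmon/iter_monotone.
have ung := iter_inflationary n ginfl uid.
by apply: (t_trans _ _ _ _ _ ung); apply: finfl; apply: (below_abs_idempotent ung).2.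
Qed.

Lemma directed_jonsson_terms :
  jonsson_chain (Var i2) -> below_abs (Var false) (Var true).
Proof. by move=> chain; have [f [_ _]] := chain_below_abs chain chain; apply. Qed.

End DirectedTerms.

(** * Relational consequences of directed Jonsson terms *)

Section Relations.
Variables (S : signature) (A : algebra S).
Implicit Types (R a b c : set (A * A)).

Lemma rel_powS R h x z :
  rel_pow R h.+1 (x, z) <-> exists2 y, rel_pow R h (x, y) & R (y, z).
Proof.
case: h => [|h]; last by split=> -[y]; exists y.
by split=> [Rxz|[y xy Ryz]]; [exists x | have -> : x = y := xy].
Qed.

Lemma rel_powD R h k x y z :
  rel_pow R h (x, y) -> rel_pow R k (y, z) -> rel_pow R (h + k) (x, z).
Proof.
move=> Rxy; elim: k z => [z yz|k IH z].
  by have <- : y = z := yz; rewrite addn0.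
by rewrite addnS => /rel_powS[w /IH yw Rwz]; apply/rel_powS; exists w.
Qed.

Lemma rel_pow_clos_trans R h x y : (0 < h)%N ->
  rel_pow R h (x, y) -> clos_trans _ (fun w w' => R (w, w')) x y.
Proof.
case: h => // h _; elim: h y => [|h IH] y; first exact: t_step.
move=> /rel_powS[w /IH xw Rwy]; exact: t_trans xw (t_step _ _ _ _ Rwy).
Qed.

Lemma rel_pow_reflexive R h : reflexive_rel R -> reflexive_rel (rel_pow R h).
Proof. by move=> Rxx x; elim: h => [|h IH] //; apply/rel_powS; exists x. Qed.

Lemma rel_pow_leq R h k : reflexive_rel R -> (h <= k)%N ->
  rel_pow R h `<=` rel_pow R k.
Proof.
move=> Rxx /subnK <- [x y] Rxy; rewrite addnC.
exact/(rel_powD Rxy)/rel_pow_reflexive.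
Qed.

Lemma comp_admissible R R' : admissible R -> admissible R' -> admissible (R \; R').
Proof.
move=> admR admR' o f g fg.
have [k fkg] := choice (fun i => let: ex_intro2 y p q := fg i in
  ex_intro (fun y => R' (f i, y) /\ R (y, g i)) y (conj p q)).
by exists (interp k) => /=; [apply: admR' | apply: admR] => i; case: (fkg i).
Qed.

Lemma rel_pow_admissible R h : admissible R -> admissible (rel_pow R h).
Proof.
move=> admR; elim: h => [|[|h] IH] //; last exact: comp_admissible.
by move=> o f g fg /=; congr interp; apply: funext.
Qed.

Lemma congruence_tolerance a : congruence a -> tolerance a.
Proof. by case. Qed.

Lemma congruence_meet a b : congruence a -> congruence b -> congruence (a `&` b).
Proof.
move=> [ar as_ at_ aa] [br bs bt ba]; split.
- by move=> x; split.
- by move=> x y [/as_ ? /bs ?]; split.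
- by move=> x y z [/at_ axy /bt bxy] [/axy ? /bxy ?].
- by move=> o f g fg; split; [apply: aa | apply: ba] => i; case: (fg i).
Qed.

Lemma congruence_joinP b c : congruence (congruence_join b c).
Proof.
split.
- by move=> x d [[]].
- by move=> x y xy d dP; have := xy d dP; case: dP => -[_ ds _ _] _ /ds.
- move=> x y z xy yz d dP; have := yz d dP; have := xy d dP.
  by case: dP => -[_ _ dt _] _; apply: dt.
- move=> o f g fg d dP; have := fun i => fg i d dP.
  by case: dP => -[_ _ _ da] _; apply: da.
Qed.

(** The transitive closure of [b `|` c] is a congruence. For admissibility it is
    seen as the increasing union of the powers of [b \; c]: as operations have
    finite arity, a single power contains all the argument pairs. *)
Lemma congruence_join_clos_trans b c x y : congruence b -> congruence c ->
  congruence_join b c (x, y) -> clos_trans _ (fun w w' => (b `|` c) (w, w')) x y.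
Proof.
move=> [br bs bt ba] [cr cs ct ca].
pose C := clos_trans _ (fun w w' => (b `|` c) (w, w')).
pose J := [set xy | C xy.1 xy.2].
suff Jcong : congruence J.
  by move/(_ J); apply; split=> // -[w w'] ww'; apply: t_step.
have Jrefl : reflexive_rel J by move=> w; apply: t_step; left.
have Jtrans : transitive_rel J by move=> ? ? ?; apply: t_trans.
split=> //.
  move=> w w'; suff : C w w' -> C w' w by [].
  elim=> [v v' [/bs|/cs] ?|v v' v'' _ ? _ ?].
  - by apply: t_step; left.
  - by apply: t_step; right.
  - by apply: (t_trans _ _ _ v').
have bc_refl : reflexive_rel (b \; c) by move=> w; exists w.
have Jpow w w' : C w w' -> exists h, rel_pow (b \; c) h (w, w').
  elim=> [v v' vv'|v v' v'' _ [h ?] _ [k ?]]; last first.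
    by exists (h + k)%N; apply: (@rel_powD _ h k v v').
  by exists 1; case: vv' => ?; [exists v | exists v'].
move=> o f g fg; have [h fhg] := choice (fun i => Jpow _ _ (fg i)).
have : rel_pow (b \; c) (\max_i h i) (interp f, interp g).
  apply: rel_pow_admissible => [|i]; first exact: comp_admissible.
  exact/(rel_pow_leq bc_refl (leq_bigmax i)).
elim: (\max_i h i) (interp g) => [z fz|k IH z].
  by have <- : interp f = z := fz; apply: Jrefl.
move=> /rel_powS[v /IH fv [v' /= cvv' bv'z]].
apply: (t_trans _ _ _ v); first exact: fv.
by apply: (t_trans _ _ _ v'); apply: t_step; [right|left].
Qed.

Lemma union_U_admissible s : @union_of_two_congruences S A s -> U_admissible s.
Proof.
move=> [b [c [[br _ _ ba] [cr _ _ ca] ->]]]; exists [set b; c]; split.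
- by exists b; left.
- by move=> R [->|->].
- by rewrite bigcup_setU !bigcup_set1.
Qed.

Lemma tolerance_congruence_inclusion h :
  tolerance_inclusion A h -> congruence_inclusion A h.
Proof.
by move=> AP a s /congruence_tolerance aT /union_U_admissible; apply: AP.
Qed.

End Relations.

Section Consequences.
Variables (S : signature) (V : algebra S -> Prop).

(** For a congruence both values are related to [a = p(a, b, a)]. Without
    transitivity, write [p(a, b, c) = p(p(a, b', a), b, p(c, b', c))] and
    [p(a, b', c) = p(p(a, b', c), b, p(a, b', c))], which differ by exchanging
    [a] and [c] inside the outer arguments. *)
Lemma absorbing_tolerance p (A : algebra S) (T : set (A * A)) (a b b' c : A) :
  absorbing V p -> V A -> tolerance T -> T (a, c) ->
  T (at3 p a b c, at3 p a b' c).
Proof.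
move=> p_abs VA [Trefl Tsym Tadm] Tac.
have -> : at3 p a b c = at3 p (at3 p a b' a) b (at3 p c b' c) by rewrite !p_abs.
rewrite -[X in T (_, X)](p_abs A VA (at3 p a b' c) b).
apply: at3_admissible => //; apply: at3_admissible => //; exact: Tsym.
Qed.

(** Each link from [u] to [v] contributes two steps, through [p(a, b, c)]. *)
Lemma below_abs_tolerance u v : below_abs V u v -> exists2 h, (0 < h)%N &
  forall (A : algebra S) (T s : set (A * A)) (a b c : A), V A -> tolerance T -> U_admissible s ->
    T (a, c) -> s (a, b) -> s (b, c) -> rel_pow (T `&` s) h (at2 u a c, at2 v a c).
Proof.
elim=> {u v} [u v [p p_abs puv]|u1 u2 u3 _ [h h0 IH] _ [k _ IH']]; last first.
  exists (h + k)%N => [|A T s a b c VA tolT sU Tac sab sbc].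
    by rewrite addn_gt0 h0.
  by apply: (@rel_powD _ _ _ h k _ (at2 u2 a c)); [apply: (IH A T s a b) | apply: (IH' A T s a b)].
exists 2 => // A T s a b c VA tolT [C [_ CP ->]] Tac [R CR Rab] [R' CR' R'bc].
have [<- <-] := puv A VA a c.
have [[Rrefl Radm] [R'refl R'adm]] := (CP R CR, CP R' CR').
exists (at3 p a b c) => /=.
  split; first exact: absorbing_tolerance.
  by exists R => //; apply: at3_admissible.
split; first exact: absorbing_tolerance.
by exists R' => //; apply: at3_admissible.
Qed.

Lemma jonsson_tolerance_inclusion : jonsson_chain V (Var i2) ->
  exists h, (0 < h)%N /\ forall A, V A -> tolerance_inclusion A h.
Proof.
move=> /directed_jonsson_terms/below_abs_tolerance[h h0 hP].
exists h; split=> // A VA T s tolT sU [a c] [Tac [b sab sbc]].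
exact: (hP A T s a b c).
Qed.

Lemma below_abs_distributive u v : below_abs V u v ->
  forall (A : algebra S) (a b c : set (A * A)) (x z : A), V A ->
    congruence a -> congruence b -> congruence c ->
    a (x, z) -> congruence_join b c (x, z) ->
    congruence_join (a `&` b) (a `&` c) (at2 u x z, at2 v x z).
Proof.
elim=> {u v} [u v [p p_abs puv]|u1 u2 u3 _ IH _ IH'] A a b c x z VA ac bc cc axz jxz;
    have [Jrefl _ Jtrans _] := congruence_joinP (a `&` b) (a `&` c); last first.
  by apply: (Jtrans _ (at2 u2 x z)); [apply: IH | apply: IH'].
have [<- <-] := puv A VA x z.
have aT := congruence_tolerance ac.
have [br _ _ badm] := bc; have [cr _ _ cadm] := cc.
suff key y y' : clos_trans _ (fun w w' => (b `|` c) (w, w')) y y' ->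
    congruence_join (a `&` b) (a `&` c) (at3 p x y z, at3 p x y' z).
  by apply: key; apply: congruence_join_clos_trans jxz.
elim=> {y y'} [y y' byy'|? ? ? _ + _ +]; last exact: Jtrans.
apply: sub_gen_smallest; case: byy' => yy'; [left|right];
  by split; [apply: absorbing_tolerance | apply: at3_admissible].
Qed.

Lemma jonsson_distributive : jonsson_chain V (Var i2) ->
  forall A, V A -> distributive_congruence_lattice A.
Proof.
move=> /directed_jonsson_terms/below_abs_distributive dP A VA a b c ac bc cc.
apply/seteqP; split=> -[x z].
  by move=> [axz jxz]; apply: (dP A a b c x z).
apply: smallest_sub => [|xz].
  exact/congruence_meet/congruence_joinP.
by case=> -[axz bxz]; split=> //; apply: sub_gen_smallest; [left|right].
Qed.

End Consequences.

(** * Jonsson terms from the free algebra on three generators *)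

Section Free.
Variables (S : signature) (V : algebra S -> Prop) (F : algebra S) (x : 'I_3 -> F).
Hypotheses (hV : variety V) (freeF : free_algebra V x).

Let VF : V F := freeF.1.

Lemma free_hom (A : algebra S) (v : 'I_3 -> A) : V A ->
  exists2 h : F -> A, homomorphism h & forall t, h (eval x t) = eval v t.
Proof.
move=> VA; have [h [[hh hx] _]] := freeF.2 A v VA; exists h => // t.
by rewrite hom_eval //; apply: eval_ext.
Qed.

(** The values of terms form a subalgebra [Galg] in the variety; composing the
    homomorphism [F -> Galg] with the inclusion fixes the generators, so it is
    the identity. *)
Lemma free_generated (w : F) : exists t, w = eval x t.
Proof.
pose G := {w : F | exists t, w = eval x t}.
have Gop o (f : 'I_(arity o) -> G) :
    exists t, interp (fun i => sval (f i)) = eval x t.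
  have [t ft] := choice (fun i => svalP (f i)).
  by exists (App o t) => /=; congr interp; apply: funext.
pose y i : G := exist _ (x i) (ex_intro _ (Var i) erefl).
pose Galg := @Algebra S G (fun o f => exist _ _ (Gop o f)) (inhabits (y i0)).
have val_hom : @homomorphism S Galg F sval by [].
have VG : V Galg.
  have [E EP] := hV; apply/EP => l r lr v.
  have : sval (eval v l : Galg) = sval (eval v r : Galg).
    by rewrite !(hom_eval _ _ val_hom); exact: (EP F).1 VF _ _ lr _.
  move: (eval v l) (eval v r) => [a aP] [b bP] /= ab.
  by move: aP bP; rewrite ab => aP bP; rewrite (Prop_irrelevance aP bP).
have [h [[hh hy] _]] := freeF.2 Galg y VG.
have [e [_ e_uniq]] := freeF.2 F x VF.
have -> : w = sval (h w); last exact: (svalP (h w)).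
have e_incl : e = (fun w => sval (h w)).
  by apply: e_uniq; split=> [o f|i]; rewrite ?hh ?hy.
have e_id : e = id by apply: e_uniq.
by have := congr1 (fun f => f w) e_incl; rewrite e_id.
Qed.

Lemma free_identity (g h k : 'I_3) (t t' : term S 'I_3) :
  at3 t (x g) (x h) (x k) = at3 t' (x g) (x h) (x k) ->
  forall A, V A -> forall v : 'I_3 -> A,
    at3 t (v g) (v h) (v k) = at3 t' (v g) (v h) (v k).
Proof.
move=> tt' A VA v; have [e [[ehom ex] _]] := freeF.2 A v VA.
have := congr1 e tt'; rewrite /at3 !(hom_eval _ _ ehom) !comp_pt3.
by rewrite !ex.
Qed.

Lemma kernel_congruence (e : F -> F) : homomorphism e ->
  congruence [set ww' : F * F | e ww'.1 = e ww'.2].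
Proof.
move=> ehom; split=> //= [? ? ? /= -> //|o f f' ff' /=]; rewrite !ehom.
by congr interp; apply: funext.
Qed.

(** [a], [b] and [c] are instantiated with the kernels of the endomorphisms that
    send the generators to [(x, y, x)], [(x, x, z)] and [(x, z, z)], so that
    [a `&` b] and [a `&` c] encode the two kinds of steps of a Jonsson chain. *)
Lemma free_chain :
  (forall a b c : set (F * F), congruence a -> congruence b -> congruence c ->
    a (x i0, x i2) -> b (x i0, x i1) -> c (x i1, x i2) ->
    clos_trans _ (fun w w' => (a `&` (b `|` c)) (w, w')) (x i0) (x i2)) ->
  jonsson_chain V (Var i2).
Proof.
have [ea eaH eat] := free_hom (pt3 (x i0) (x i1) (x i0)) VF.
have [eb ebH ebt] := free_hom (pt3 (x i0) (x i0) (x i2)) VF.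
have [ec ecH ect] := free_hom (pt3 (x i0) (x i2) (x i2)) VF.
move=> /(_ _ _ _ (kernel_congruence eaH) (kernel_congruence ebH)
  (kernel_congruence ecH)) /=.
rewrite (eat (Var i0)) (eat (Var i2)) (ebt (Var i0)) (ebt (Var i1)).
rewrite (ect (Var i1)) (ect (Var i2)) => /(_ erefl erefl erefl) reach.
have : exists2 t, x i2 = eval x t & jonsson_chain V t.
  have : exists2 t, x i0 = eval x t & jonsson_chain V t.
    by exists (Var i0) => //; constructor.
  elim: reach => [w w' [eaww' ebcww'] [t wt chain]|]; last by auto.
  have [t' wt'] := free_generated w'; exists t' => //.
  move: eaww' ebcww'; rewrite /= wt wt' !eat !ebt !ect => eatt' ebctt'.
  have t'_abs : absorbing V t'.
    move=> A VA y z; rewrite -(free_identity eatt' VA (pt3 y z y)).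
    exact: (chain_absorbing chain VA).
  case: ebctt' => tt'.
    by apply: (chain_left chain) => // A VA y z; apply: (free_identity tt' VA (pt3 y z z)).
  by apply: (chain_right chain) => // A VA y z; apply: (free_identity tt' VA (pt3 y z z)).
case=> t xt chain; apply: (chain_left chain) => // A VA y z.
apply: (@free_identity i0 i1 i2 t (Var i2) _ A VA (pt3 y y z)).
by rewrite /at3 pt3_eta.
Qed.

Lemma free_distributive_chain :
  distributive_congruence_lattice F -> jonsson_chain V (Var i2).
Proof.
move=> dF; apply: free_chain => a b c ac bc cc axz bxy cyz.
have := congruence_join_clos_trans (congruence_meet ac bc) (congruence_meet ac cc).
rewrite -setIUr; apply; rewrite -dF //; split=> //.
have [_ _ jt _] := congruence_joinP b c.
by apply: jt (x i1) _ _ _; apply: sub_gen_smallest; [left|right].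
Qed.

Lemma free_inclusion_chain k :
  (0 < k)%N -> congruence_inclusion F k -> jonsson_chain V (Var i2).
Proof.
move=> k0 kF; apply: free_chain => a b c ac bc cc axz bxy cyz.
apply: (rel_pow_clos_trans k0); apply: kF => //; first by exists b, c.
by split=> //; exists (x i1); [left|right].
Qed.

End Free.

Theorem theorem2p1 (S : signature) (V : algebra S -> Prop) (hV : variety V) :
  [/\ (forall A, V A -> distributive_congruence_lattice A) <->
      (exists h, (0 < h)%N /\ forall A, V A -> tolerance_inclusion A h),
      (exists h, (0 < h)%N /\ forall A, V A -> tolerance_inclusion A h) <->
      (exists k, (0 < k)%N /\ forall A, V A -> congruence_inclusion A k)
    & forall (F : algebra S) (x : 'I_3 -> F), free_algebra V x ->
      [/\ (forall A, V A -> distributive_congruence_lattice A) <->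
          distributive_congruence_lattice F,
          (exists h, (0 < h)%N /\ forall A, V A -> tolerance_inclusion A h) <->
          (exists h, (0 < h)%N /\ tolerance_inclusion F h)
        & (exists k, (0 < k)%N /\ forall A, V A -> congruence_inclusion A k) <->
          (exists k, (0 < k)%N /\ congruence_inclusion F k)]].
Proof.
have J1 := @jonsson_distributive S V; have J2 := @jonsson_tolerance_inclusion S V.
have J3 : jonsson_chain V (Var i2) ->
    exists k, (0 < k)%N /\ forall A, V A -> congruence_inclusion A k.
  move=> /J2[h [h0 hV']]; exists h; split=> // A VA.
  exact/tolerance_congruence_inclusion/hV'.
have [F0 [x0 free0]] := free_algebra_exists i0 hV.
split.
- split=> [dV|[h [h0 hV']]].
    exact/J2/(free_distributive_chain hV free0)/dV/free0.1.
  apply/J1/(free_inclusion_chain hV free0 h0)/tolerance_congruence_inclusion.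
  exact/hV'/free0.1.
- split=> [[h [h0 hV']]|[k [k0 kV]]].
    by exists h; split=> // A VA; apply/tolerance_congruence_inclusion/hV'.
  exact/J2/(free_inclusion_chain hV free0 k0)/kV/free0.1.
move=> F x freeF; have VF := freeF.1; split.
- split=> [dV|dF]; first exact: dV.
  exact/J1/(free_distributive_chain hV freeF).
- split=> [[h [h0 hV']]|[h [h0 hF]]]; first by exists h; split=> //; apply: hV'.
  exact/J2/(free_inclusion_chain hV freeF h0)/tolerance_congruence_inclusion.
- split=> [[k [k0 kV]]|[k [k0 kF]]]; first by exists k; split=> //; apply: kV.
  exact/J3/(free_inclusion_chain hV freeF k0).
Qed.
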